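(* Let $F16$ denote the Möbius–Kantor graph. For each positive integer $m\equiv 2\pmod 4$, the graph $K(mF16)$ is a connected Cayley graph that has no Hamilton decomposition.
   Context: The Möbius–Kantor graph is the $3$-valent graph of order $16$ with vertices $u_i,v_i$ for $i\in\mathbb{Z}_8$ and edges $\{u_i,u_{i+1}\}$, $\{u_i,v_i\}$, $\{v_i,v_{i+3}\}$ for $i\in\mathbb{Z}_8$ (the generalized Petersen graph $GP(8,3)$). For a graph $X$ and positive integer $m$, $mX$ is the multigraph on the vertices of $X$ with $m$ distinct edges $\{x,y\}_0,\ldots,\{x,y\}_{m-1}$ joining $x$ and $y$ for each edge $\{x,y\}$ of $X$. Its arcs are $(x,y)_0,\ldots,(x,y)_{m-1}$ for each arc $(x,y)$ of $X$ (an arc being an ordered pair of adjacent vertices), the two arcs $(x,y)_i$ and $(y,x)_i$ being associated with the edge $\{x,y\}_i$. For $X$ regular of valency $k\ge 1$, $K(mX)$ is the simple graph whose vertices are the arcs of $mX$, in which two distinct vertices are adjacent if and only if either they are arcs emanating from the same vertex (i.e. $(x,y)_i$ and $(x,z)_j$), or they are $(x,y)_i$ and $(y,x)_i$ for some edge $\{x,y\}_i$ of $mX$. It is $km$-valent. A Hamilton decomposition of a $d$-valent graph is a set of $\lfloor d/2\rfloor$ pairwise edge-disjoint Hamilton cycles in it. A graph is a Cayley graph if it is isomorphic to $\mathrm{Cay}(G;S)$ for some group $G$ and some inverse-closed subset $S\subseteq G$ not containing the identity, where $\mathrm{Cay}(G;S)$ has vertex set $G$ and edges $\{g,gs\}$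 for $g\in G$, $s\in S$; equivalently, its automorphism group has a subgroup acting regularly on the vertices. *)

(* Defs.v *)
From HB Require Import structures.
From mathcomp Require Import all_boot all_order all_algebra all_fingroup.

Set Implicit Arguments.
Unset Strict Implicit.
Unset Printing Implicit Defensive.

Record sgraph := SGraph {
  svertex :> finType;
  adj : rel svertex;
  adj_sym : symmetric adj;
  adj_irrefl : irreflexive adj
}.
Arguments adj {s}.

Definition valent (d : nat) (X : sgraph) : Prop :=
  forall x : X, #|[set y : X | adj x y]| = d.

Definition connected_graph (X : sgraph) : Prop :=
  0 < #|X| /\ forall x y : X, connect adj x y.

Definition graph_isomorphic (X Y : sgraph) : Prop :=
  exists2 f : X -> Y, bijective f & forall x y : X, adj (f x) (f y) = adj x y.

Section Cayley.
Variables (gT : finGroupType) (S : {set gT}).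
Hypotheses (S1 : 1%g \notin S) (SV : forall s, s \in S -> s^-1%g \in S).

Definition cay_adj : rel gT := fun g h => [exists s in S, h == g * s]%g.

Lemma cay_adj_sym : symmetric cay_adj.
Proof.
suff cayS g h : cay_adj g h -> cay_adj h g by move=> g h; apply/idP/idP; apply: cayS.
case/exists_inP=> s Ss /eqP->; apply/exists_inP; exists s^-1%g; first exact: SV.
by rewrite mulgK.
Qed.

Lemma cay_adj_irrefl : irreflexive cay_adj.
Proof.
move=> g; apply/negbTE/negP=> /exists_inP[s Ss /eqP/(congr1 (mulg g^-1%g))].
by rewrite mulKg mulVg => s1; move: S1; rewrite s1 Ss.
Qed.

Definition Cay : sgraph := SGraph cay_adj_sym cay_adj_irrefl.
End Cayley.

(* A graph isomorphic to Cay(G; S) has as many vertices as G has elements, so *)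
(* for a finite graph it is enough to quantify over finite groups.            *)
Definition is_cayley_graph (X : sgraph) : Prop :=
  exists (gT : finGroupType) (S : {set gT}) (S1 : 1%g \notin S)
         (SV : forall s, s \in S -> s^-1%g \in S),
    graph_isomorphic X (Cay S1 SV).

(* Edges are two-element vertex sets, and a Hamilton cycle is identified with *)
(* its set of edges, so that the starting point and the direction of the      *)
(* cyclic sequence c are irrelevant.                                          *)
Definition hamilton_cycle (X : sgraph) (H : {set {set X}}) : Prop :=
  exists c : seq X,
    [/\ 2 < size c, ucycle adj c, forall x : X, x \in c
      & H = [set [set x; next c x] | x : X]].

(* To be used with d the valency of X.                                        *)
Definition hamilton_decomposition (d : nat) (X : sgraph)
    (D : {set {set {set X}}}) : Prop :=
  [/\ #|D| = d./2, forall H, H \in D -> hamilton_cycle H & trivIset D].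

Definition has_hamilton_decomposition (d : nat) (X : sgraph) : Prop :=
  exists D : {set {set {set X}}}, hamilton_decomposition d D.

Section ArcGraph.
Variables (m : nat) (X : sgraph).

(* The arc (x,y)_i of mX is the triple (x, y, i).                             *)
Definition arc : finType := {a : X * X * 'I_m | adj a.1.1 a.1.2}.

Definition arc_tail (a : arc) : X := (val a).1.1.
Definition arc_head (a : arc) : X := (val a).1.2.
Definition arc_index (a : arc) : 'I_m := (val a).2.

Definition arc_opposite : rel arc := fun a b =>
  [&& arc_tail b == arc_head a, arc_head b == arc_tail a
    & arc_index b == arc_index a].

Definition K_adj : rel arc := fun a b =>
  (a != b) && ((arc_tail a == arc_tail b) || arc_opposite a b).

Lemma K_adj_sym : symmetric K_adj.
Proof.
move=> a b; rewrite /K_adj /arc_opposite eq_sym (eq_sym (arc_tail a)).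
rewrite (eq_sym (arc_tail b) (arc_head a)) (eq_sym (arc_head b)).
by rewrite (eq_sym (arc_index b)) andbCA.
Qed.

Lemma K_adj_irrefl : irreflexive K_adj.
Proof. by move=> a; rewrite /K_adj eqxx. Qed.

Definition K : sgraph := SGraph K_adj_sym K_adj_irrefl.

Lemma K_valent k : valent k X -> valent (k * m) K.
Proof.
move=> vX a; pose x := arc_tail a; pose y := arc_head a.
have xy : adj x y := valP a.
have yx : adj y x by rewrite adj_sym.
pose a' : arc := exist (fun a : X * X * 'I_m => adj a.1.1 a.1.2)
  (y, x, arc_index a) yx.
pose E := [set b : arc | arc_tail b == x].
have aE : a \in E by rewrite inE.
have a'E : a' \notin E.
  by rewrite inE; apply/eqP=> e; move: xy; rewrite -[X in adj X _]e adj_irrefl.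
have -> : [set b : K | adj (a : K) b] = a' |: (E :\ a).
  apply/setP=> b; rewrite !inE /= /K_adj /arc_opposite -/x -/y.
  have -> : [&& arc_tail b == y, arc_head b == x & arc_index b == arc_index a]
            = (b == a').
    rewrite -[RHS](inj_eq val_inj) /arc_tail /arc_head /arc_index.
    by case: (val b) => [[b1 b2] b3]; rewrite !xpair_eqE andbA.
  rewrite (eq_sym a b) (eq_sym x); case: (eqVneq b a') => [->|_] /=.
    rewrite orbT andbT; apply/eqP=> e; move: a'E; rewrite e; by rewrite aE.
  by rewrite orbF.
rewrite cardsU1 !inE negb_and negbK (_ : arc_tail a' == x = false) ?orbT; last first.
  by apply/negbTE; move: a'E; rewrite inE.
have -> : (1 + #|E :\ a| = #|E|)%N by rewrite (cardsD1 a E) aE.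
pose f (b : arc) := (arc_head b, arc_index b).
have finj : {in E &, injective f}.
  move=> b c; rewrite !inE => /eqP tb /eqP tc [hbc ibc]; apply: val_inj.
  move: tb tc hbc ibc; rewrite /arc_tail /arc_head /arc_index.
  by case: (val b) (val c) => [[? ?] ?] [[? ?] ?] /= -> -> -> ->.
rewrite -(card_in_imset finj) -(vX x) -[m in RHS]card_ord -cardsT -cardsX.
apply: eq_card => -[z i]; rewrite !inE andbT /=; apply/imsetP/idP.
  by case=> b; rewrite inE => /eqP tb [-> _]; rewrite -tb; apply: (valP b).
move=> xz; exists (exist (fun a : X * X * 'I_m => adj a.1.1 a.1.2) (x, z, i) xz) => //.
by rewrite inE.
Qed.
End ArcGraph.

(* u_i is inl i and v_i is inr i.                                             *)
Definition F16_adj : rel ('Z_8 + 'Z_8) := fun x y =>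
  match x, y with
  | inl i, inl j => (j == i + 1) || (i == j + 1)
  | inl i, inr j | inr i, inl j => i == j
  | inr i, inr j => (j == i + 3%:R) || (i == j + 3%:R)
  end%R.

Lemma F16_adj_sym : symmetric F16_adj.
Proof.
case=> i [] j; rewrite /F16_adj; [exact: orbC | exact: eq_sym | exact: eq_sym |].
exact: orbC.
Qed.

Lemma Z8_eq_addr (i c : 'Z_8) : (i == i + c)%R = (c == 0%R).
Proof. by rewrite -{1}[i]GRing.addr0 (inj_eq (GRing.addrI i)) eq_sym. Qed.

Lemma F16_adj_irrefl : irreflexive F16_adj.
Proof. by case=> i; rewrite /F16_adj orbb Z8_eq_addr. Qed.

Definition F16 : sgraph := SGraph F16_adj_sym F16_adj_irrefl.

Lemma Z8_eq_step (i j c : 'Z_8) : (i == j + c)%R = (j == i - c)%R.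
Proof. by rewrite -GRing.subr_eq eq_sym. Qed.

Lemma Z8_step_neq (i c : 'Z_8) : (c + c)%R != 0%R -> (i + c == i - c)%R = false.
Proof.
move=> c2; rewrite -(Z8_eq_step i (i + c)%R c) -GRing.addrA Z8_eq_addr.
exact: negbTE.
Qed.

Lemma F16_valent : valent 3 F16.
Proof.
case=> i.
- have -> : [set y : F16 | adj (inl i : F16) y]
    = [set inl (i + 1)%R; inl (i - 1)%R; inr i].
    apply/setP=> -[] j; rewrite in_set !in_setU !in_set1.
      rewrite -[adj _ _]/((j == i + 1) || (i == j + 1))%R (Z8_eq_step i j) orbF.
      by rewrite !(inj_eq (@inl_inj _ _)).
    by rewrite -[adj _ _]/(i == j) eq_sym.
  rewrite setUC cardsU1 cards2 in_set2 !(inj_eq (@inl_inj _ _)).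
  by rewrite Z8_step_neq.
- have -> : [set y : F16 | adj (inr i : F16) y]
    = [set inr (i + 3%:R)%R; inr (i - 3%:R)%R; inl i].
    apply/setP=> -[] j; rewrite in_set !in_setU !in_set1.
      by rewrite -[adj _ _]/(i == j) eq_sym.
    rewrite -[adj _ _]/((j == i + 3%:R) || (i == j + 3%:R))%R (Z8_eq_step i j) orbF.
    by rewrite !(inj_eq (@inr_inj _ _)).
  rewrite setUC cardsU1 cards2 in_set2 !(inj_eq (@inr_inj _ _)).
  by rewrite Z8_step_neq.
Qed.

(* This is the valency at which Hamilton decompositions are considered.       *)
Lemma K_F16_valent (m : nat) : valent (3 * m) (K m F16).
Proof. exact: (K_valent F16_valent). Qed.

(* Main.v *)
From mathcomp Require Import all_boot all_order all_algebra all_fingroup.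
Require Import Defs.

Set Implicit Arguments.
Unset Strict Implicit.
Unset Printing Implicit Defensive.

(** Write A_x for the clique of K(mX) formed by the arcs that leave x, and call
    link an edge of K(mX) joining an arc to its opposite.

    No Hamilton decomposition. A Hamilton cycle enters and leaves every clique
    A_x, so it uses at least two of the km links at A_x, where k is the valency
    of X. If km is even, the km/2 cycles of a Hamilton decomposition share these
    km links, hence each of them uses exactly two links at each clique
    ([links_at_eq2]) and every link is used once. Contracting the cliques turns
    each cycle of the decomposition into a subgraph of X, its [shadow], which is
    2-valent ([shadow_valent]) and connected ([shadow_cut]), that is, a Hamilton
    cycle of X, and each edge of X lies in exactly m shadows ([sum_shadow]). For
    X = F16 there are three edges such that each Hamilton cycle of F16 contains
    an odd number of them ([odd_marks]). When m = 2 mod 4, there are 3m/2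
    shadows, an odd number, so the marked edges are covered an odd number of
    times in all; but they are covered 3m times, which is even.

    Cayley graph. Let GL(2,3) act on the pairs (s, p) with s a sign and p a
    nonzero vector of F_3^2, a matrix of determinant -1 changing s, and join
    (s, p) to (-s, q) when det(p, q) = s. This is F16 ([point], [side],
    [det_frame]), and GL(2,3) permutes its arcs regularly: an arc is an ordered
    basis of F_3^2, that is, a matrix in GL(2,3). Thus the vertices of K(mF16)
    are the elements of GL(2,3) x Z_m. Two of them, with matrices M and M', have
    the same tail when M^-1 M' fixes the first basis vector and has determinant
    1, and are opposite when M^-1 M' exchanges the two basis vectors and the
    indices are equal; so adjacency depends only on the quotient of the two elements. *)

(** * Cyclic sequences and disjoint families *)

Lemma next_exit (T : finType) (c : seq T) (P : pred T) (x y : T) :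
  uniq c -> x \in c -> y \in c -> P x -> ~~ P y ->
  exists z, [/\ z \in c, P z & ~~ P (next c z)].
Proof.
move=> uc xc yc Px Py.
have: fconnect (next c) x y by rewrite (fconnect_cycle (cycle_next uc) xc).
case/connectP=> p; elim: p x xc Px => [|z p IHp] x xc Px /=.
  by move=> _ eyx; rewrite eyx Px in Py.
case/andP=> /eqP <- pz ey; case Pz: (P (next c x)); last by exists x; rewrite Pz.
by apply: (IHp (next c x)); rewrite ?mem_next.
Qed.

Lemma next_next_neq (T : finType) (c : seq T) (x : T) :
  uniq c -> 2 < size c -> x \in c -> next c (next c x) != x.
Proof.
move=> uc sc xc; apply/eqP=> nnx.
have lt2 : 2 < fingraph.order (next c) x by rewrite (order_cycle (cycle_next uc) uc xc).
by have := findex_iter lt2; rewrite /= nnx findex0.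
Qed.

Lemma sum_mem_trivIset (T : finType) (D : {set {set T}}) (e : T) :
  trivIset D -> \sum_(H in D) (e \in H) = (e \in cover D).
Proof.
move=> tD; have [/bigcupP[H0 DH0 eH0]|eD] := boolP (e \in cover D).
  rewrite (bigD1 H0) //= eH0 big1 // => H /andP[DH HH0].
  case eH: (e \in H) => //.
  by rewrite -(def_pblock tD DH eH) (def_pblock tD DH0 eH0) eqxx in HH0.
rewrite big1 // => H DH; case eH: (e \in H) => //.
by case/negP: eD; apply/bigcupP; exists H.
Qed.

(** * Arcs and links *)

Section ArcGraphFacts.
Variables (m : nat) (X : sgraph).
Implicit Types (a b : arc m X) (x y : X) (H : {set {set K m X}}).

Lemma arc_adj a : adj (arc_tail a) (arc_head a).
Proof. exact: (valP a). Qed.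

Lemma arc_ext a b : arc_tail a = arc_tail b -> arc_head a = arc_head b ->
  arc_index a = arc_index b -> a = b.
Proof.
move=> tab hab iab; apply: val_inj; move: tab hab iab.
rewrite /arc_tail /arc_head /arc_index.
by case: (val a) (val b) => [[? ?] ?] [[? ?] ?] /= -> -> ->.
Qed.

Definition mkarc x y (xy : adj x y) (i : 'I_m) : arc m X :=
  exist (fun a : X * X * 'I_m => adj a.1.1 a.1.2) (x, y, i) xy.

Definition opposite a : arc m X :=
  mkarc (etrans (adj_sym (arc_head a) (arc_tail a)) (arc_adj a)) (arc_index a).

Lemma tail_opposite a : arc_tail (opposite a) = arc_head a. Proof. by []. Qed.
Lemma head_opposite a : arc_head (opposite a) = arc_tail a. Proof. by []. Qed.

Lemma arc_oppositeE a b : arc_opposite a b = (b == opposite a).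
Proof.
apply/and3P/eqP => [[/eqP ? /eqP ? /eqP ?]|->]; last by rewrite !eqxx.
exact: arc_ext.
Qed.

Lemma oppositeK : involutive opposite.
Proof. by move=> a; apply: arc_ext. Qed.

Definition link a : {set K m X} := [set a; opposite a].

Lemma link_opposite a : link (opposite a) = link a.
Proof. by rewrite /link oppositeK setUC. Qed.

Definition links_at H x : {set arc m X} :=
  [set a | (arc_tail a == x) && (link a \in H)].

Lemma card_arcs_at k x :
  valent k X -> #|[set a : arc m X | arc_tail a == x]| = k * m.
Proof.
move=> vX; pose f a := (arc_head a, arc_index a).
have finj : {in [set a : arc m X | arc_tail a == x] &, injective f}.
  move=> a b; rewrite !inE => /eqP ta /eqP tb [hab iab].
  by apply: arc_ext; rewrite ?ta ?tb.
rewrite -(card_in_imset finj) -(vX x) -[m in RHS]card_ord -cardsT -cardsX.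
apply: eq_card => -[z i]; rewrite !inE andbT /=; apply/imsetP/idP.
  by case=> a; rewrite inE => /eqP <- [-> _]; apply: arc_adj.
by move=> xz; exists (mkarc xz i); rewrite ?inE.
Qed.

Lemma card_arcs k : valent k X -> #|arc m X| = #|X| * (k * m).
Proof.
move=> vX; rewrite -[LHS]sum1_card (partition_big (@arc_tail m X) xpredT) //=.
rewrite -sum_nat_const; apply: eq_bigr => x _.
by rewrite -(card_arcs_at x vX) -sum1dep_card.
Qed.

(** An edge of K(mX) that changes the tail is a link, so the cycle crosses the
    boundary of S along links only: once outwards from an arc z, and once
    inwards from an arc w. The links at z and at w are different, as otherwise
    w would both follow and precede z on the cycle. *)
Lemma hamilton_cycle_leaves H (S : {pred X}) a b :
  hamilton_cycle H -> arc_tail a \in S -> arc_tail b \notin S ->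
  exists a1 a2, [/\ a1 != a2, (arc_tail a1 \in S) && (arc_tail a2 \in S),
    (arc_head a1 \notin S) && (arc_head a2 \notin S)
    & (link a1 \in H) && (link a2 \in H)].
Proof.
case=> c [c2 /andP[cc uc] cT ->] aS bS.
pose P (z : K m X) := arc_tail z \in S.
have nextP z : P z != P (next c z) -> next c z = opposite z.
  have := next_cycle cc (cT z); rewrite /= /K_adj /P; case/andP=> _ /orP[/eqP->|].
    by rewrite eqxx.
  by rewrite arc_oppositeE => /eqP.
have linkP z : P z != P (next c z) ->
    link z \in [set [set x; next c x] | x : K m X].
  by move=> /nextP nz; apply/imsetP; exists z; rewrite // nz.
have [z [_ Pz nPz]] := next_exit (P := P) uc (cT a) (cT b) aS bS.
have [||w [_ nPw Pw]] := next_exit (P := predC P) uc (cT b) (cT a).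
- by [].
- by rewrite /= negbK.
rewrite /= negbK in nPw Pw.
have nz : next c z = opposite z by apply: nextP; rewrite Pz (negbTE nPz).
have nw : next c w = opposite w by apply: nextP; rewrite Pw (negbTE nPw).
have lz := linkP z; rewrite Pz (negbTE nPz) in lz.
have lw := linkP w; rewrite Pw (negbTE nPw) in lw.
exists z, (opposite w); split.
- apply: contra (next_next_neq uc c2 (cT w)) => /eqP ez.
  by rewrite nw -ez nz ez oppositeK.
- by apply/andP; split; rewrite -?nw.
- by apply/andP; split; rewrite // -tail_opposite -?nz // oppositeK.
- by rewrite link_opposite lz ?lw.
Qed.

Lemma sum_card_links (D : {set {set {set K m X}}}) (P : pred (arc m X)) :
  trivIset D ->
  \sum_(H in D) #|[set a | P a & link a \in H]|
    = #|[set a | P a & link a \in cover D]|.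
Proof.
move=> tD; have cardE (E : {set {set K m X}}) :
    #|[set a | P a & link a \in E]| = \sum_(a | P a) (link a \in E).
  by rewrite -sum1dep_card big_mkcondr; apply: eq_bigr => a _; case: (_ \in _).
under eq_bigr do rewrite cardE.
by rewrite exchange_big cardE; apply: eq_bigr => a _; rewrite sum_mem_trivIset.
Qed.

(** * Shadows of the cycles of a Hamilton decomposition *)

(** The subgraph of X obtained from H by contracting every clique A_x to x. *)
Definition shadow H : rel X := fun x y =>
  [exists a, [&& arc_tail a == x, arc_head a == y & link a \in H]].

Lemma shadowP H x y :
  reflect (exists a, [/\ arc_tail a = x, arc_head a = y & link a \in H])
          (shadow H x y).
Proof.
apply: (iffP existsP) => -[a]; first by case/and3P=> /eqP ? /eqP ? ?; exists a.
by case=> ta ha la; exists a; rewrite ta ha la !eqxx.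
Qed.

Lemma shadow_sym H : symmetric (shadow H).
Proof.
suff s x y : shadow H x y -> shadow H y x by move=> x y; apply/idP/idP; apply: s.
case/shadowP=> a [<- <- l]; apply/shadowP.
by exists (opposite a); rewrite link_opposite.
Qed.

Lemma shadow_adj H x y : shadow H x y -> adj x y.
Proof. by case/shadowP=> a [<- <- _]; apply: arc_adj. Qed.

Section Decomposed.
Variables (k : nat) (D : {set {set {set K m X}}}).
Hypotheses (k_gt0 : 0 < k) (m_gt0 : 0 < m) (vX : valent k X).
Hypotheses (even_km : ~~ odd (k * m)) (decD : hamilton_decomposition (k * m) D).

Let arc_at x : exists a : arc m X, arc_tail a = x.
Proof.
have: 0 < #|[set a : arc m X | arc_tail a == x]|.
  by rewrite (card_arcs_at _ vX) muln_gt0 k_gt0.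
by case/card_gt0P=> a; rewrite inE => /eqP; exists a.
Qed.

Let leaves H (S : {pred X}) x y : H \in D -> x \in S -> y \notin S ->
  exists a1 a2, [/\ a1 != a2, (arc_tail a1 \in S) && (arc_tail a2 \in S),
    (arc_head a1 \notin S) && (arc_head a2 \notin S)
    & (link a1 \in H) && (link a2 \in H)].
Proof.
case: decD => _ hD _ DH; have [[a <-] [b <-]] := (arc_at x, arc_at y).
exact: (hamilton_cycle_leaves (hD _ DH)).
Qed.

Lemma links_at_ge2 H x : H \in D -> 1 < #|links_at H x|.
Proof.
move=> DH; have [a ax] := arc_at x; have := arc_adj a; rewrite ax => xy.
have [||a1 [a2 [n12 /andP[t1 t2] _ /andP[l1 l2]]]] :=
    leaves (S := pred1 x) (x := x) (y := arc_head a) DH.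
- by rewrite inE.
- by rewrite inE; apply: contraTneq xy => ->; rewrite adj_irrefl.
by apply/card_gt1P; exists a1, a2; split=> //; rewrite inE; apply/andP; split.
Qed.

(** Each of the km/2 cycles takes at least two of the km links at x, and the
    cycles share no link: there is equality everywhere. *)
Lemma links_at_eq2 x :
  (forall H, H \in D -> #|links_at H x| = 2) /\
  (forall a, arc_tail a = x -> link a \in cover D).
Proof.
case: decD => cD _ tD.
have sumD : \sum_(H in D) 2 = k * m.
  by rewrite sum_nat_const cD muln2 even_halfK.
have le2 : \sum_(H in D) 2 <= \sum_(H in D) #|links_at H x|
    ?= iff [forall (H | H \in D), 2 == #|links_at H x|].
  by apply: leqif_sum => H DH; split=> //; apply: links_at_ge2.
have sumE := sum_card_links (fun a => arc_tail a == x) tD.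
have sub : [set a | arc_tail a == x & link a \in cover D]
    \subset [set a : arc m X | arc_tail a == x].
  by apply/subsetP=> a; rewrite !inE => /andP[].
have eqk : \sum_(H in D) #|links_at H x| = k * m.
  apply/eqP; rewrite eqn_leq -[X in _ && (X <= _)]sumD le2 andbT.
  by rewrite sumE -(card_arcs_at x vX); apply: subset_leq_card.
split=> [H DH|a ta].
  by have := le2.2; rewrite sumD eqk eqxx => /esym/forall_inP/(_ H DH)/eqP->.
have /eqP/setP/(_ a): [set a | arc_tail a == x & link a \in cover D]
    == [set a : arc m X | arc_tail a == x].
  by rewrite eqEcard sub (card_arcs_at x vX) -eqk sumE leqnn.
by rewrite !inE ta eqxx.
Qed.

(** Connectedness of the shadow, in terms of cuts. *)
Lemma shadow_cut H (S : {pred X}) x y : H \in D -> x \in S -> y \notin S ->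
  exists w z, [/\ w \in S, z \notin S & shadow H w z].
Proof.
move=> DH Sx Sy.
have [a [_ [_ /andP[ta _] /andP[ha _] /andP[la _]]]] := leaves DH Sx Sy.
by exists (arc_tail a), (arc_head a); split=> //; apply/shadowP; exists a.
Qed.

Hypothesis X_gt2 : 2 < #|X|.

(** If the two links of H at x both led to y, they would also be the two links
    at y, and H could not leave {x, y}. *)
Lemma head_inj H x :
  H \in D -> {in links_at H x &, injective (fun a => arc_head a)}.
Proof.
move=> DH a b aL bL hab; apply: contraTeq X_gt2 => nab; rewrite -leqNgt.
have [y hy] : {y | arc_head a = y} by exists (arc_head a).
have at2 z c c' : c != c' -> c \in links_at H z -> c' \in links_at H z ->
    forall d, d \in links_at H z -> (d == c) || (d == c').
  move=> ncc' cL c'L d; suff <- : [set c; c'] = links_at H z by rewrite !inE.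
  apply/eqP; rewrite eqEcard cards2 ncc' (proj1 (links_at_eq2 z) H DH) andbT.
  by apply/subsetP=> e /set2P[]->.
have opL c : c \in links_at H x -> arc_head c = y -> opposite c \in links_at H y.
  by rewrite !inE link_opposite tail_opposite => /andP[_ ->] ->; rewrite eqxx.
have hx c : c \in links_at H x -> arc_tail c = x by rewrite inE => /andP[/eqP].
pose S : {pred X} := pred2 x y.
suff: [forall z, z \in S].
  move/forallP=> allS; apply: leq_trans (_ : #|S| <= 2).
    by apply: subset_leq_card; apply/subsetP=> z _; apply: allS.
  by rewrite card2; case: (_ == _).
apply: contraT; rewrite negb_forall => /existsP[z Sz].
have [|c [_ [_ /andP[tc _] /andP[hc _] /andP[lc _]]]] := leaves DH _ Sz (x := x).
  by rewrite !inE eqxx.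
have Lc w : arc_tail c = w -> c \in links_at H w by move=> <-; rewrite inE eqxx.
case/negP: hc; move: tc; rewrite !inE => /orP[]/eqP tc.
  case/orP: (at2 x a b nab aL bL c (Lc x tc)) => /eqP->.
    by rewrite hy eqxx orbT.
  by rewrite -hab hy eqxx orbT.
have nab' : opposite a != opposite b by rewrite (inj_eq (inv_inj oppositeK)).
have oaL := opL a aL hy; have obL := opL b bL (etrans (esym hab) hy).
case/orP: (at2 y _ _ nab' oaL obL c (Lc y tc)) => /eqP->.
  by rewrite -[arc_head _]/(arc_tail _) hx // eqxx.
by rewrite -[arc_head _]/(arc_tail _) hx // eqxx.
Qed.

Lemma shadow_valent H x : H \in D -> #|[set y | shadow H x y]| = 2.
Proof.
move=> DH; rewrite -(proj1 (links_at_eq2 x) H DH) -(card_in_imset (head_inj DH)).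
apply: eq_card => y; rewrite inE; apply/shadowP/imsetP => [[a [tx hy l]]|[a]].
  by exists a; rewrite ?inE ?tx ?eqxx.
by rewrite inE => /andP[/eqP tx l] ->; exists a.
Qed.

(** Each of the m links over the edge {x,y} is used by one cycle, and no cycle
    uses two of them. *)
Lemma sum_shadow x y : adj x y -> \sum_(H in D) shadow H x y = m.
Proof.
move=> xy; have [_ _ tD] := decD.
pose P := [pred a : arc m X | (arc_tail a == x) && (arc_head a == y)].
have -> : \sum_(H in D) shadow H x y
    = \sum_(H in D) #|[set a | P a & link a \in H]|.
  apply: eq_bigr => H DH; apply/eqP; rewrite eq_sym eqn_leq; apply/andP; split.
    case: (posnP #|[set a | P a & link a \in H]|) => [->//|].
    case/card_gt0P=> a; rewrite !inE => /andP[/andP[/eqP ta /eqP ha] la].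
    rewrite (_ : shadow H x y); last by apply/shadowP; exists a.
    apply/card_le1_eqP=> b c; rewrite !inE => /andP[/andP[tb /eqP hb] lb].
    case/andP=> /andP[tc /eqP hc] lc; apply: (head_inj DH (x := x)).
    - by rewrite inE tc.
    - by rewrite inE tb.
    - by rewrite hc.
  case: shadowP => // -[a [ta ha la]]; rewrite card_gt0; apply/set0Pn.
  by exists a; rewrite !inE ta ha !eqxx.
have mk_inj : injective (mkarc xy).
  by move=> i j /(congr1 (fun a => arc_index a)).
rewrite (sum_card_links _ tD) -[RHS]card_ord -(card_imset _ mk_inj).
apply: eq_card => a; rewrite !inE.
apply/andP/imsetP => [[/andP[/eqP ta /eqP ha] _]|[i _ ->]].
  by exists (arc_index a) => //; apply: arc_ext.
by rewrite !eqxx (proj2 (links_at_eq2 x)).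
Qed.

End Decomposed.
End ArcGraphFacts.

(** * Hamilton cycles of F16 *)

(** Indices are read modulo 8. *)
Definition u (i : nat) : F16 := inl (inZp i).
Definition v (i : nat) : F16 := inr (inZp i).

Definition F16_vertices : seq F16 := map u (iota 0 8) ++ map v (iota 0 8).

Lemma mem_F16_vertices x : x \in F16_vertices.
Proof.
by case: x => i; rewrite mem_cat; apply/orP; [left | right]; apply/mapP;
  exists (val i); rewrite ?mem_iota ?(ltn_ord i) //; congr (_ _); rewrite valZpK.
Qed.

Lemma all_F16P (P : pred F16) : reflect (forall x, P x) (all P F16_vertices).
Proof.
by apply: (iffP allP) => [h x|h x _]; [apply: h; apply: mem_F16_vertices | apply: h].
Qed.

(** The bipartition of F16. *)
Definition side (x : F16) : bool :=
  match x with inl i => odd i | inr i => ~~ odd i end.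

Lemma adj_side x y : adj x y -> side y = ~~ side x.
Proof.
suff: all (fun x => all (fun y => adj x y ==> (side y == ~~ side x)) F16_vertices)
  F16_vertices.
  by move/all_F16P/(_ x)/all_F16P/(_ y)/implyP=> h /h /eqP.
by vm_compute.
Qed.

Definition even_side : seq F16 := filter (predC side) F16_vertices.

(** The matchings of s into V, each given by the sequence of the partners of
    the vertices in s. *)
Fixpoint matchings (X : sgraph) (V s : seq X) : seq (seq X) :=
  if s is x :: s' then
    flatten [seq [seq y :: t | y <- V & adj x y && (y \notin t)] | t <- matchings V s']
  else [:: [::]].

Lemma map_matching (X : sgraph) (V s : seq X) (o : X -> X) :
  (forall x, x \in V) -> injective o -> uniq s -> (forall x, adj x (o x)) ->
  map o s \in matchings V s.
Proof.
move=> allV o_inj + ao; elim: s => //= x s IHs /andP[xs us].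
apply/flattenP; exists [seq y :: map o s | y <- V & adj x y && (y \notin map o s)].
  by apply/mapP; exists (map o s); rewrite ?IHs.
by apply/mapP; exists (o x); rewrite // mem_filter allV ao mem_map ?xs.
Qed.

(** The edges of F16 outside the perfect matching t, where t lists the partners
    of the vertices in [even_side]. *)
Definition unmatched (t : seq F16) : rel F16 := fun x y =>
  let e := if side x then (y, x) else (x, y) in
  adj x y && (e.2 != nth e.1 t (index e.1 even_side)).

Definition rel_edges (r : rel F16) : seq (F16 * F16) :=
  [seq e <- allpairs pair F16_vertices F16_vertices | r e.1 e.2].

(** Sixteen rounds, one for each vertex of F16, reach all that can be reached
    from x; [separated] tests directly that the result is closed. *)
Definition component (es : seq (F16 * F16)) (x : F16) : seq F16 :=
  iter 16 (fun C => undup (C ++ [seq e.2 | e <- es & e.1 \in C])) [:: x].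

Definition separated (es : seq (F16 * F16)) (C : seq F16) : bool :=
  [&& u 0 \in C, has (fun x => x \notin C) F16_vertices
    & all (fun e => (e.1 \in C) ==> (e.2 \in C)) es].

Definition disconnected (r : rel F16) : bool :=
  let es := rel_edges r in separated es (component es (u 0)).

(** The number of marked edges in r. The graph F16 has six Hamilton cycles, and
    each edge is missed by exactly two of them. The marked edges are chosen such
    that, for some three of the six cycles, each pair of these three misses one
    marked edge. Hence every Hamilton cycle misses zero or two marked edges. *)
Definition marks (r : rel F16) : nat := r (u 0) (u 1) + r (u 2) (v 2) + r (v 0) (v 3).

Lemma matchings_marks :
  all (fun t => disconnected (unmatched t) || odd (marks (unmatched t)))
    (matchings F16_vertices even_side).
Proof. by vm_compute. Qed.

(** As F16 is cubic, a 2-valent spanning subgraph r is the complement of a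
    perfect matching, whose edges are the pairs {x, o x}. For each of the 33
    perfect matchings of F16, either the complement is disconnected, and then r
    has an empty cut, or the number of marks is odd. *)
Lemma odd_marks (r : rel F16) :
  symmetric r -> subrel r adj -> (forall x, #|[set y | r x y]| = 2) ->
  (forall (S : {pred F16}) x y, x \in S -> y \notin S ->
     exists w z, [/\ w \in S, z \notin S & r w z]) ->
  odd (marks r).
Proof.
move=> r_sym r_adj r_val r_cut.
have ex_o x : exists y, adj x y /\ forall z, r x z = adj x z && (z != y).
  pose N := [set y : F16 | adj x y]; pose R := [set y | r x y].
  have RN : R \subset N by apply/subsetP=> y; rewrite !inE; apply: r_adj.
  have /cards1P[y /setP defy] : #|N :\: R| == 1%N.
    by rewrite cardsD (setIidPr RN) r_val (F16_valent x).
  have := defy y; rewrite !inE eqxx => /andP[_ xy]; exists y; split=> // z.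
  have := defy z; rewrite !inE => <-; rewrite negb_and negbK.
  by move: (r_adj x z); case: (r x z) => [-> //|_]; case: (adj x z).
have [o oP] := fin_all_exists ex_o.
have oK : involutive o.
  move=> x; apply/eqP; rewrite eq_sym; have [xo _] := oP x.
  have : r (o x) x = false by rewrite r_sym (oP x).2 eqxx andbF.
  by rewrite (oP (o x)).2 adj_sym xo /= => /negbFE.
have t_in : map o even_side \in matchings F16_vertices even_side.
  apply: map_matching; first exact: mem_F16_vertices.
  - exact: inv_inj.
  - by vm_compute.
  - by move=> x; case: (oP x).
have even_sideP x : ~~ side x -> x \in even_side.
  by move=> sx; rewrite mem_filter mem_F16_vertices /= sx.
have rE : r =2 unmatched (map o even_side).
  have E x y : ~~ side x ->
      r x y = adj x y && (y != nth x (map o even_side) (index x even_side)).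
    move=> sx; rewrite (nth_map x) ?index_mem ?nth_index ?even_sideP //.
    exact: (oP x).2.
  move=> x y; rewrite /unmatched; case: ifPn => [sx|]; last exact: E.
  case xy: (adj x y); last by apply: contraFF xy => /r_adj.
  by rewrite r_sym E ?(adj_side xy) ?sx // adj_sym xy.
have -> : marks r = marks (unmatched (map o even_side)) by rewrite /marks !rE.
have /orP[|odd_r] := allP matchings_marks _ t_in; last exact: odd_r.
rewrite /disconnected; move: (component _ _) => C /and3P[C0 /hasP[x _ Cx] /allP clC].
have [w [z [Cw Cz rwz]]] := r_cut (mem C) _ _ C0 Cx.
have wz_edge : (w, z) \in rel_edges (unmatched (map o even_side)).
  by rewrite mem_filter -rE rwz allpairs_f ?mem_F16_vertices.
by case/negP: Cz; have /implyP h := clC _ wz_edge; apply: h.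
Qed.

Lemma odd_sum (I : finType) (D : {set I}) (f : I -> nat) :
  (forall i, i \in D -> odd (f i)) -> odd (\sum_(i in D) f i) = odd #|D|.
Proof.
move=> odd_f; rewrite -sum1_card; pose E a b := odd a = odd b.
by apply: (big_rec2 E) => // i a b Di; rewrite /E !oddD odd_f // => ->.
Qed.

(** The 3m/2 shadows contain the marked edges 3m times in all; 3m is even,
    whereas 3m/2 is odd and so is the contribution of each shadow. *)
Lemma K_F16_undecomposable m : 0 < m -> m = 2 %[mod 4] ->
  ~ has_hamilton_decomposition (3 * m) (K m F16).
Proof.
move=> m_gt0 m_mod4 [D decD].
have def_m : m = (m %/ 4 * 2).+1.*2.
  by rewrite {1}(divn_eq m 4) m_mod4 -muln2 mulSn -mulnA addnC.
have even_3m : ~~ odd (3 * m) by rewrite oddM def_m odd_double.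
have odd_D : odd #|D|.
  by have [-> _ _] := decD; rewrite def_m -doubleMr doubleK oddM /= oddM andbF.
have gt2 : 2 < #|F16| by rewrite card_sum !card_ord.
have sumE := sum_shadow (isT : 0 < 3) m_gt0 F16_valent even_3m decD gt2.
have : odd (\sum_(H in D) marks (shadow H)) = odd #|D|.
  apply: odd_sum => H DH; apply: odd_marks.
  - exact: shadow_sym.
  - by move=> x y; apply: shadow_adj.
  - by move=> x; apply: (shadow_valent _ _ F16_valent even_3m decD).
  - by move=> S x y; apply: (shadow_cut _ _ F16_valent decD).
rewrite odd_D !big_split /= !sumE //.
by rewrite !oddD addbb addFb def_m odd_double.
Qed.

(** * Connectedness *)

Lemma K_connected (m k : nat) (X : sgraph) :
  0 < m -> 0 < k -> valent k X -> connected_graph X -> connected_graph (K m X).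
Proof.
move=> m_gt0 k_gt0 vX [X_gt0 cX]; split=> [|a b].
  by rewrite (card_arcs m vX) !muln_gt0 X_gt0 k_gt0.
have same_tail (c d : K m X) : arc_tail c = arc_tail d -> connect adj c d.
  move=> tcd; have [->|ncd] := eqVneq c d; first exact: connect0.
  by apply: connect1; rewrite /= /K_adj ncd tcd eqxx.
have /connectP[p] := cX (arc_tail a) (arc_tail b).
elim: p a => [|y p IHp] a /= => [_ /esym/same_tail // | /andP[xy py] eb].
pose c : K m X := mkarc xy (arc_index a).
apply: connect_trans (same_tail a c _) _ => //.
apply: connect_trans (connect1 _) (IHp (opposite c) py eb).
rewrite /= /K_adj arc_oppositeE eqxx orbT andbT.
apply/eqP=> /(congr1 (@arc_tail m X)) e; move: (arc_adj c).
by rewrite -tail_opposite -e adj_irrefl.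
Qed.

Lemma F16_connected : connected_graph F16.
Proof.
have spoke i : connect adj (v i : F16) (u i) by apply: connect1; rewrite /= eqxx.
have rim i : connect adj (u i : F16) (u 0).
  elim: i => [|i IHi]; first exact: connect0.
  apply: connect_trans (connect1 _) IHi; rewrite /= orbC; apply/orP; left.
  by apply/eqP/val_inj; rewrite /= modnDml modnDmr addn1.
have to_u0 (x : F16) : connect adj x (u 0).
  case: x => i; rewrite -[i]valZpK; first exact: rim.
  exact: connect_trans (spoke i) (rim i).
have csym : connect_sym (adj : rel F16) by apply/sym_connect_sym/adj_sym.
split=> [|x y]; first by apply/card_gt0P; exists (u 0).
by apply: connect_trans (to_u0 x) _; rewrite csym.
Qed.

(** * Arcs of F16 as matrices in GL(2,3) *)

Import GRing.Theory.

Section Cayley.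
Local Open Scope ring_scope.

Lemma det2E (R : comNzRingType) (M : 'M[R]_2) :
  \det M = M 0 0 * M 1 1 - M 0 1 * M 1 0.
Proof.
rewrite (expand_det_row _ 0) !big_ord_recl big_ord0 /cofactor !det_mx11 !mxE /=.
rewrite expr0 expr1 mul1r mulN1r mulrN addr0; congr (_ * M _ _ - M _ _ * M _ _).
all: by apply/val_inj.
Qed.

(** The powers of a generator w of the multiplicative group of F_9, where
    w^2 = w + 1, in the basis (1, w) of F_9 over F_3. *)
Definition omega_power (n : nat) : 'F_3 * 'F_3 :=
  iter n (fun p => (p.2, p.1 + p.2)) (1, 0).

(** The vertex u_i is sent to w^i and v_i to w^(i+2). Multiplication by w has
    determinant -1 and corresponds to the rotation i -> i+1 of F16, which
    exchanges the two sides. *)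
Definition exponent (x : F16) : nat :=
  match x with inl i => i | inr i => (i + 2)%N end.

Definition point (x : F16) : 'cV['F_3]_2 :=
  let p := omega_power (exponent x) in \col_i (if i == 0 then p.1 else p.2).

Lemma point_inj x y : point x = point y -> side x = side y -> x = y.
Proof.
suff: all (fun x => all (fun y =>
    (omega_power (exponent x) == omega_power (exponent y)) ==> (side x == side y) ==>
    (x == y)) F16_vertices) F16_vertices.
  move/all_F16P/(_ x)/all_F16P/(_ y)=> h /colP exy sxy.
  rewrite sxy eqxx /= in h; apply/eqP/(implyP h).
  have := exy 0; have := exy 1; rewrite !mxE /=.
  by case: (omega_power _) (omega_power _) => [a b] [c d] /= -> ->.
by vm_compute.
Qed.

Definition frame (x y : F16) : 'M['F_3]_2 :=
  \matrix_(i, j) (if j == 0 then point x else point y) i 0.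

Lemma col_frame0 x y : col 0 (frame x y) = point x.
Proof. by apply/colP=> i; rewrite !mxE. Qed.

Lemma col_frame1 x y : col 1 (frame x y) = point y.
Proof. by apply/colP=> i; rewrite !mxE. Qed.

Lemma det_frame x y : adj x y -> \det (frame x y) = (-1) ^+ side x.
Proof.
have -> : \det (frame x y) =
    let p := omega_power (exponent x) in let q := omega_power (exponent y) in
    p.1 * q.2 - q.1 * p.2.
  have e i : frame x y i 0 = point x i 0 by rewrite !mxE.
  have e' i : frame x y i 1 = point y i 0 by rewrite !mxE.
  by rewrite det2E !e !e' !mxE.
suff: all (fun x => all (fun y => adj x y ==>
    (let p := omega_power (exponent x) in let q := omega_power (exponent y) in
    p.1 * q.2 - q.1 * p.2 == (-1) ^+ side x)) F16_vertices) F16_vertices.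
  by move/all_F16P/(_ x)/all_F16P/(_ y)/implyP=> h /h /eqP.
by vm_compute.
Qed.

Lemma frame_inj x y x' y' : adj x y -> adj x' y' ->
  frame x y = frame x' y' -> x = x' /\ y = y'.
Proof.
move=> xy xy' eM.
have sx : side x = side x'.
  have := congr1 determinant eM; rewrite !det_frame //.
  by case: (side x) (side x') => -[] //= /eqP.
split; apply: point_inj; rewrite ?(adj_side xy) ?(adj_side xy') ?sx //.
- by rewrite -(col_frame0 x y) -(col_frame0 x' y') eM.
- by rewrite -(col_frame1 x y) -(col_frame1 x' y') eM.
Qed.

(** * K(mF16) as a Cayley graph *)

(** The index set is written m.+1 so that it carries the group Z_(m+1). *)
Section Labels.
Variable m : nat.
Implicit Types a b : arc m.+1 F16.
Local Notation G := ({'GL_2['F_3]} * 'I_m.+1)%type.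

Definition arc_frame a : 'M['F_3]_2 := frame (arc_tail a) (arc_head a).

Lemma det_arc_frame a : \det (arc_frame a) = (-1) ^+ side (arc_tail a).
Proof. exact/det_frame/arc_adj. Qed.

Lemma arc_frame_unit a : arc_frame a \is a GRing.unit.
Proof.
rewrite -[_ \is a _]/(arc_frame a \in unitmx) unitmxE det_arc_frame.
by rewrite unitrX ?unitrN1.
Qed.

Lemma swap_unit : (tperm_mx 0 1 : 'M['F_3]_2) \is a GRing.unit.
Proof. exact: unitmx_perm. Qed.

Definition label a : G := (FinRing.unit _ (arc_frame_unit a), arc_index a).

Definition swap : {'GL_2['F_3]} := FinRing.unit _ swap_unit.

Definition shears : {set {'GL_2['F_3]}} :=
  [set g | (col 0 (GLval g) == col 0 1%:M) && (\det (GLval g) == 1)].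

Definition K_connection : {set G} :=
  [set g : G | (g != 1%g) && (g.1 \in shears)] :|: [set (swap, 1%g)].

Lemma label_inj : injective label.
Proof.
move=> a b [eM ei].
have [] := frame_inj (arc_adj a) (arc_adj b) eM.
by move=> ta ha; apply: arc_ext.
Qed.

Lemma label_bij : bijective label.
Proof.
apply: inj_card_bij label_inj _.
rewrite card_prod -cardsT card_GL_2 card_Fp // card_ord (card_arcs _ F16_valent).
by rewrite card_sum !card_ord mulnA.
Qed.

Lemma label_onto (g : G) : exists a, label a = g.
Proof. by have [l _ lK] := label_bij; exists (l g). Qed.

(** With M and M' the matrices of a and b, the first column of M^-1 M' is the
    first basis vector exactly when M and M' have the same first column, and its
    determinant is 1 exactly when their determinants agree; these two data are
    the point and the side of the tail. *)
Lemma mem_shearsE a b :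
  (((label a)^-1 * label b)%g.1 \in shears) = (arc_tail a == arc_tail b).
Proof.
pose M := arc_frame a; pose M' := arc_frame b.
have uM : M \in unitmx := arc_frame_unit a.
have colM (A B : 'M['F_3]_2) : col 0 (A *m B) = A *m col 0 B by rewrite !colE mulmxA.
rewrite inE -[GLval _]/(invmx M *m M') colM det_mulmx det_inv.
have -> : (invmx M *m col 0 M' == col 0 1%:M)
    = (point (arc_tail a) == point (arc_tail b)).
  rewrite -[point (arc_tail a)](col_frame0 _ (arc_head a)) -[frame _ _]/M.
  rewrite -[point (arc_tail b)](col_frame0 _ (arc_head b)) -[frame _ _]/M'.
  apply/eqP/eqP=> [e|<-]; last by rewrite -colM mulVmx.
  by rewrite -[RHS](mulKVmx uM) e -colM mulmx1.
have uD : \det M != 0 by rewrite -unitfE -unitmxE.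
rewrite mulrC -(inj_eq (mulIf uD)) divfK // mul1r !det_arc_frame.
apply/andP/eqP=> [[/eqP ep /eqP es]|->]; last by rewrite !eqxx.
apply: point_inj => //; move: es.
by case: (side _) (side _) => -[] //= /eqP.
Qed.

Lemma label_opposite a : label (opposite a) = (label a * (swap, 1))%g.
Proof.
congr (_, _); last by rewrite /= mulg1.
apply: val_inj; rewrite /= -[RHS]/(arc_frame a *m tperm_mx 0 1) -xcolE.
apply/matrixP=> i j; rewrite !mxE.
have: (j == 0) || (j == 1) by case: j => [[|[|]]].
by case/orP=> /eqP->; rewrite ?tpermL ?tpermR.
Qed.

Lemma mem_K_connection a b :
  ((label a)^-1 * label b \in K_connection)%g = K_adj a b.
Proof.
rewrite /K_adj arc_oppositeE -(inj_eq label_inj b) label_opposite.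
rewrite in_setU in_set1 inE mem_shearsE.
rewrite -(inj_eq (mulgI (label a)) (_^-1 * _)%g 1%g).
rewrite -(inj_eq (mulgI (label a)) (_^-1 * _)%g (swap, 1%g)).
rewrite mulKVg mulg1 (inj_eq label_inj) (eq_sym b).
have [->|//] := eqVneq a b.
apply/eqP; rewrite -label_opposite => /label_inj/(congr1 (@arc_tail _ _)) e.
by move: (arc_adj b); rewrite -tail_opposite -e adj_irrefl.
Qed.

Lemma K_connection1 : 1%g \notin K_connection.
Proof.
have [a _] := label_onto 1%g.
by rewrite -(mulVg (label a)) mem_K_connection /K_adj eqxx.
Qed.

(** Every element of the group is a quotient of two labels, so this is the
    symmetry of the adjacency in K(mF16). *)
Lemma K_connectionV g : g \in K_connection -> (g^-1)%g \in K_connection.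
Proof.
have [[a a1] [b <-]] := (label_onto 1%g, label_onto g).
rewrite -[label b]mul1g -[X in (X * _)%g]invg1 -a1 mem_K_connection.
by rewrite invMg invgK mem_K_connection K_adj_sym.
Qed.

Lemma K_F16_cayley : is_cayley_graph (K m.+1 F16).
Proof.
exists G, K_connection, K_connection1, K_connectionV.
exists (label : K m.+1 F16 -> _); first exact: label_bij.
move=> a b; rewrite /= -mem_K_connection.
apply/exists_inP/idP=> [[s Ss /eqP->]|]; first by rewrite mulKg.
by exists ((label a)^-1 * label b)%g; rewrite ?mulKVg.
Qed.

End Labels.
End Cayley.

Theorem theorem12 (m : nat) (m_gt0 : 0 < m) (m_mod4 : m = 2 %[mod 4]) :
  [/\ connected_graph (K m F16),
      is_cayley_graph (K m F16)
    & ~ has_hamilton_decomposition (3 * m) (K m F16)].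
Proof.
split; last exact: K_F16_undecomposable.
  exact: K_connected F16_valent F16_connected.
by case: m m_gt0 {m_mod4} => // m _; apply: K_F16_cayley.
Qed.
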